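(* Let $X,Y$ be smooth reflexive Banach spaces, let $T,\delta T\in B(X,Y)$ and put $\bar T=T+\delta T$. Assume that $\mathcal N(T)$ and $\mathcal N(\bar T)$ are Chebyshev subspaces of $X$ and $\mathcal R(T)$ and $\mathcal R(\bar T)$ are Chebyshev subspaces of $Y$, let $T^M$ be the Moore--Penrose metric generalized inverse of $T$, and assume that $T^M$ is quasi-additive on $\mathcal R(\delta T)$ and $\|T^M\delta T\|<1$. Let $b,\delta b\in Y$, $\bar b=b+\delta b$, with $\pi_{\mathcal R(T)}b\neq0$, and let $$\tilde S(T,b)=\{x\in X:\|Tx-b\|=\inf_{y\in X}\|Ty-b\|\},\qquad \tilde S(\bar T,\bar b)=\{z\in X:\|\bar Tz-\bar b\|=\inf_{y\in X}\|\bar Ty-\bar b\|\}.$$ Put $\kappa=\|T^M\|\,\|T\|$ and $\epsilon_T=\|\delta T\|/\|T\|$. Assume that $\mathcal N(\bar T)=\mathcal N(T)$ and $\mathcal R(\bar T)=\mathcal R(T)$. If $T^M$ is quasi-additive on $\mathcal R(T)$, then for any $z\in\tilde S(\bar T,\bar b)$ there exists $x\in\tilde S(T,b)$ such that $$\frac{\|z-x\|}{\|x\|}\le\frac{\kappa}{1-\|T^M\delta T\|}\left(\frac{\|\bar b\|+\|b\|}{\|\pi_{\mathcal R(T)}b\|}+\epsilon_T\right).$$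
   Context: $B(X,Y)$ is the space of bounded linear operators from $X$ to $Y$; $\mathcal N(\cdot)$ and $\mathcal R(\cdot)$ denote null space and range. A Banach space is smooth if for each unit vector $x$ there is a unique norm-one functional $f$ with $f(x)=1$. A bounded homogeneous operator $A:Y\to X$ is a map sending bounded sets to bounded sets with $A(\lambda y)=\lambda A(y)$ for all $y\in Y$, $\lambda\in\mathbb R$; its norm is $\|A\|=\sup\{\|Ay\|:\|y\|=1\}$. A map $A:Y\to X$ is quasi-additive on $M\subset Y$ if $A(y+z)=A(y)+A(z)$ for all $y\in Y$, $z\in M$. A subspace $G$ of a Banach space $Z$ is Chebyshev if each $z\in Z$ has exactly one nearest point in $G$, denoted $\pi_G(z)$; $\pi_G$ is the metric projector onto $G$. For $T\in B(X,Y)$ with $\mathcal N(T)$, $\mathcal R(T)$ Chebyshev, the Moore--Penrose metric generalized inverse of $T$ is the (existing and unique) bounded homogeneous operator $T^M:Y\to X$ with $TT^MT=T$, $T^MTT^M=T^M$, $T^MT=I_X-\pi_{\mathcal N(T)}$, $TT^M=\pi_{\mathcal R(T)}$. Products of operators denote composition; since $T^M$ is quasi-additive on $\mathcal R(\delta T)$, $T^M\delta T$ is a bounded linear operator on $X$. *)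

(* Defs.v *)
From HB Require Import structures.
From mathcomp Require Import all_boot all_order all_algebra.
From mathcomp Require Import all_classical all_reals all_analysis.

Set Implicit Arguments.
Unset Strict Implicit.
Unset Printing Implicit Defensive.

Import Order.TTheory GRing.Theory Num.Theory.
Import numFieldNormedType.Exports.

Local Open Scope classical_set_scope.
Local Open Scope ring_scope.

(* Real supremum: on a bounded homogeneous map it is the usual norm, with value
   0 when V is trivial; on an unbounded map it has the junk value 0. *)
Definition opnorm (R : realType) (V W : normedModType R) (f : V -> W) : R :=
  sup [set `|f x| | x in [set x | `|x| = 1]].

(* The elements of the dual are plain functions, so that their equality is
   pointwise equality. *)
Definition dual (R : realType) (X : normedModType R) : set (X -> R^o) :=
  [set f | linear f /\ bounded_fun_norm f].

(* Bounded linear functionals on the dual normed by opnorm. The values of Phi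
   outside dual X are irrelevant. *)
Definition bidual (R : realType) (X : normedModType R) :
    set ((X -> R^o) -> R) :=
  [set Phi |
    (forall (a : R) (f g : X -> R^o), dual f -> dual g ->
       Phi (fun x => a * f x + g x) = a * Phi f + Phi g) /\
    (exists M : R, forall f : X -> R^o, dual f -> `|Phi f| <= M * opnorm f)].

Definition reflexive_space (R : realType) (X : normedModType R) : Prop :=
  forall Phi : (X -> R^o) -> R, bidual Phi ->
    exists x : X, forall f : X -> R^o, dual f -> Phi f = f x.

Definition smooth_space (R : realType) (X : normedModType R) : Prop :=
  forall x : X, `|x| = 1 ->
    exists! f : X -> R^o, [/\ dual f, opnorm f = 1 & f x = 1].

Definition nearest (R : realType) (Z : normedModType R) (G : set Z) (z : Z) :
    set Z :=
  [set g | G g /\ forall h, G h -> `|z - g| <= `|z - h|].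

Definition chebyshev_subspace (R : realType) (Z : normedModType R)
    (G : set Z) : Prop :=
  submod_closed [in G] /\ forall z, exists! g, nearest G z g.

(* Meaningful when G is Chebyshev; the default value 0 is only taken when z has
   no nearest point in G. *)
Definition metric_proj (R : realType) (Z : normedModType R) (G : set Z)
    (z : Z) : Z :=
  xget 0 (nearest G z).

Definition null_space (R : realType) (X Y : normedModType R) (T : X -> Y) :
    set X :=
  T @^-1` [set 0].

(* bounded_fun_norm A: A is bounded on every ball, i.e. it maps bounded sets to
   bounded sets. *)
Definition bounded_homogeneous (R : realType) (Y X : normedModType R)
    (A : Y -> X) : Prop :=
  bounded_fun_norm A /\ scalable A.

Definition quasi_additive (R : realType) (Y X : normedModType R)
    (A : Y -> X) (M : set Y) : Prop :=
  forall y z, M z -> A (y + z) = A y + A z.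

Definition mp_metric_inverse (R : realType) (X Y : normedModType R)
    (T : X -> Y) (TM : Y -> X) : Prop :=
  [/\ bounded_homogeneous TM,
      T \o TM \o T =1 T,
      TM \o T \o TM =1 TM,
      TM \o T =1 (fun x => x - metric_proj (null_space T) x) &
      T \o TM =1 metric_proj (range T)].

Definition best_approx_solutions (R : realType) (X Y : normedModType R)
    (T : X -> Y) (b : Y) : set X :=
  [set x | `|T x - b| = inf (range (fun y => `|T y - b|))].

(* Main.v *)
(* A best approximate solution z of the perturbed problem solves
   (T + dT) z = pi (b + db), whence TM (T z) + TM (dT z) = TM (b + db)
   by quasi-additivity.
   With p the nearest point to z in the null space of T, the vector
   x = TM b + p is a best approximate solution of the original problem and
   z - x = TM (b + db) - TM b - TM (dT (z - x)) - TM (dT x).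
   Take norms, absorb the term in z - x, and divide by |x|, using
   |pi b| = |T x| <= |T| |x|. *)
Require Import Defs.
From HB Require Import structures.
From mathcomp Require Import all_boot all_order all_algebra.
From mathcomp Require Import all_classical all_reals all_analysis.
From mathcomp Require Import ring.
Import Order.TTheory GRing.Theory Num.Theory.
Import numFieldNormedType.Exports.
Local Open Scope classical_set_scope.
Local Open Scope ring_scope.


Section OperatorNorm.
Context {R : realType}.

Lemma opnorm_ge0 {V W : normedModType R} (f : V -> W) : 0 <= opnorm f.
Proof.
rewrite /opnorm; set A := [set _ | _ in _].
(* Without a supremum, [sup] is 0 by default; this covers a trivial domain and an unbounded [f]. *)
have [supA|/sup_out->//] := pselect (has_sup A).
have [[_ [x x1 _]] ubA] := supA.
by apply: le_trans (normr_ge0 (f x)) _; apply: ub_le_sup => //; exists x.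
Qed.

(** Homogeneity reduces the bound to the unit sphere, where boundedness makes the supremum a genuine
    upper bound. The form covers the nonlinear [TM] as well as [T] and [dT]. *)
Lemma le_opnorm {V W : normedModType R} {f : V -> W} :
  bounded_homogeneous f -> forall x, `|f x| <= opnorm f * `|x|.
Proof.
move=> [fB fZ] x; have [->|x0] := eqVneq x 0.
  by rewrite -(scale0r 0) fZ !scale0r !normr0 mulr0.
have nx0 : 0 < `|x| by rewrite normr_gt0.
have u1 : `| `|x|^-1 *: x | = 1.
  by rewrite normrZ normfV normr_id mulVf// gt_eqF.
have -> : `|f x| = `|f (`|x|^-1 *: x)| * `|x|.
  by rewrite fZ normrZ normfV normr_id mulrAC mulVf ?mul1r// gt_eqF.
rewrite ler_wpM2r//; apply: ub_le_sup; last by exists (`|x|^-1 *: x).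
have [M fM] := fB 1; exists M => _ [y /= y1 <-].
by apply: fM; rewrite y1.
Qed.

Lemma bounded_homogeneous_comp {U V W : normedModType R}
    {f : U -> V} {g : V -> W} :
  bounded_homogeneous f -> bounded_homogeneous g ->
  bounded_homogeneous (g \o f).
Proof.
move=> [fB fZ] [gB gZ]; split; last by move=> a x /=; rewrite fZ gZ.
move=> r; have [M fM] := fB r; have [N gN] := gB M.
by exists N => x /fM /gN.
Qed.

End OperatorNorm.

Section BestApproximation.
Context {R : realType}.

Lemma nearest_metric_proj {Z : normedModType R} {G : set Z} :
  chebyshev_subspace G -> forall z, nearest G z (metric_proj G z).
Proof.
move=> [_ chebG] z; have [g [gz _]] := chebG z.
by apply: xgetPex; exists g.
Qed.

Lemma metric_projE {Z : normedModType R} {G : set Z} {z g : Z} :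
  chebyshev_subspace G -> nearest G z g -> metric_proj G z = g.
Proof.
move=> chebG gz; have [_ /(_ z)[h [_ hz]]] := chebG.
by rewrite -(hz _ (nearest_metric_proj chebG z)) (hz _ gz).
Qed.

(** The infimum is the distance from [b] to the range of [T], and the nearest point there is
    unique. *)
Lemma best_approx_solutionsP {X Y : normedModType R} {T : X -> Y} {b : Y}
    {x : X} :
  chebyshev_subspace (range T) ->
  best_approx_solutions T b x <-> T x = metric_proj (range T) b.
Proof.
move=> chebT; have lb0 : has_lbound (range (fun y => `|T y - b|)).
  by exists 0 => _ [y _ <-].
split=> [xb|Txb].
  apply/esym/metric_projE => //; split; first by exists x.
  move=> _ [y _ <-]; rewrite distrC [leRHS]distrC xb.
  by apply: ge_inf => //; exists y.
apply/eqP; rewrite eq_le; apply/andP; split.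
  apply: lb_le_inf; first by exists `|T x - b|, x.
  move=> _ [y _ <-]; rewrite Txb distrC [leRHS]distrC.
  by have [_] := nearest_metric_proj chebT b; apply; exists y.
by apply: ge_inf => //; exists x.
Qed.

End BestApproximation.

Theorem theorem4p4 (R : realType) (X Y : completeNormedModType R)
    (smoothX : smooth_space X) (smoothY : smooth_space Y)
    (reflX : reflexive_space X) (reflY : reflexive_space Y)
    (T dT : {linear X -> Y})
    (bndT : bounded_fun_norm T) (bnddT : bounded_fun_norm dT)
    (chebNT : chebyshev_subspace (null_space T))
    (chebNTb : chebyshev_subspace (null_space (T \+ dT)))
    (chebRT : chebyshev_subspace (range T))
    (chebRTb : chebyshev_subspace (range (T \+ dT)))
    (TM : Y -> X) (hTM : mp_metric_inverse T TM)
    (qaddT : quasi_additive TM (range dT))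
    (TMdT_lt1 : opnorm (TM \o dT) < 1)
    (b db : Y) (pib_neq0 : metric_proj (range T) b != 0)
    (eqN : null_space (T \+ dT) = null_space T)
    (eqR : range (T \+ dT) = range T)
    (qaT : quasi_additive TM (range T)) :
  let kappa := opnorm TM * opnorm T in
  let eps_T := opnorm dT / opnorm T in
  forall z : X, best_approx_solutions (T \+ dT) (b + db) z ->
  exists2 x : X, best_approx_solutions T b x &
    `|z - x| / `|x| <=
      kappa / (1 - opnorm (TM \o dT)) *
      ((`|b + db| + `|b|) / `|metric_proj (range T) b| + eps_T).
Proof.
move=> kappa eps_T z.
have [TMB TTMT TMTTM TMTE TTME] := hTM.
have TB : bounded_homogeneous T by split=> // a x; exact: linearZ.
have dTB : bounded_homogeneous dT by split=> // a x; exact: linearZ.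
have TMdTB := bounded_homogeneous_comp dTB TMB.
move=> /(best_approx_solutionsP chebRTb); rewrite eqR -TTME /= => Tbz.
set p := metric_proj (null_space T) z.
have Tp : T p = 0 by have [] := nearest_metric_proj chebNT z.
(* Sharing the null-space component [p] with [z] makes it cancel in [z - x]. *)
set x := TM b + p.
have Tx : T x = metric_proj (range T) b by rewrite linearD Tp addr0 -TTME.
exists x; first exact/best_approx_solutionsP.
have TMdTD u v : TM (dT (u + v)) = TM (dT u) + TM (dT v).
  by rewrite linearD qaddT//; exists v.
(* Here [z - p] is [TM (T z)]; quasi-additivity merges the two terms into [TM (T z + dT z)], and
   [TM \o T \o TM =1 TM] concludes. *)
have TMbb : z - p + TM (dT z) = TM (b + db).
  have /= := TMTE z; rewrite -/p => <-.
  rewrite -qaddT; last by exists z.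
  by rewrite Tbz; apply: TMTTM.
have zxE : z - x = TM (b + db) - TM b - (TM (dT (z - x)) + TM (dT x)).
  by rewrite -TMdTD subrK -TMbb addrAC addrK /x opprD addrA addrAC.
have pib_gt0 : 0 < `|metric_proj (range T) b| by rewrite normr_gt0.
(* With [pib_neq0], this bound forces both [opnorm T] and [|x|] to be positive, so the divisions are
   genuine. *)
have pib_le : `|metric_proj (range T) b| <= opnorm T * `|x|.
  by rewrite -Tx le_opnorm.
have Tx_gt0 := lt_le_trans pib_gt0 pib_le.
have T_neq0 : opnorm T != 0.
  by apply: contraTneq Tx_gt0 => ->; rewrite mul0r ltxx.
have x_gt0 : 0 < `|x|.
  rewrite lt_def normr_ge0 andbT.
  by apply: contraTneq Tx_gt0 => ->; rewrite mulr0 ltxx.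
have d_gt0 : 0 < 1 - opnorm (TM \o dT) by rewrite subr_gt0.
have zx_le : (1 - opnorm (TM \o dT)) * `|z - x| <=
    opnorm TM * (`|b + db| + `|b|) + opnorm TM * opnorm dT * `|x|.
  rewrite mulrBl mul1r lerBlDr {1}zxE mulrDr -[leRHS]addrA.
  apply: le_trans (ler_normB _ _) _; apply: lerD.
    by apply: le_trans (ler_normB _ _) _; apply: lerD; exact: le_opnorm.
  rewrite [leRHS]addrC; apply: le_trans (ler_normD _ _) _.
  (* The [z - x] term keeps the norm of the composite, to be absorbed; the [x] term is split into
     [opnorm TM * opnorm dT], which yields [eps_T]. *)
  apply: lerD; first exact: (le_opnorm TMdTB).
  apply: le_trans (le_opnorm TMB _) _; rewrite -mulrA.
  by rewrite ler_wpM2l ?opnorm_ge0// le_opnorm.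
(* The factor [opnorm T] of [kappa] cancels in [eps_T] and otherwise joins the projection to form a
   ratio that is at least [1 / |x|] by [pib_le]. *)
have -> : kappa / (1 - opnorm (TM \o dT)) *
    ((`|b + db| + `|b|) / `|metric_proj (range T) b| + eps_T) =
    (opnorm TM * ((`|b + db| + `|b|) *
      (opnorm T / `|metric_proj (range T) b|)) + opnorm TM * opnorm dT) /
    (1 - opnorm (TM \o dT)).
  by rewrite /kappa /eps_T; field; rewrite T_neq0 (gt_eqF pib_gt0) (gt_eqF d_gt0).
rewrite ler_pdivrMr// mulrAC ler_pdivlMr// mulrC.
apply: le_trans zx_le _; rewrite mulrDl lerD2r -2!mulrA.
rewrite ler_wpM2l ?opnorm_ge0// ler_peMr ?addr_ge0//.
by rewrite mulrAC ler_pdivlMr// mul1r.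
Qed.
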